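(* Let $G=(V,E)$ be an undirected graph with $n=|V|$, let $R\ge 1$ be the number of sketches and let $\alpha\in(0,1]$ be the compression parameter. Consider the PaC-IM compressed sketch scheme described in the context. Then (i) maintaining the $R$ sketches requires $O((1+\alpha R)n)$ space, and (ii) re-evaluating the marginal gain of a single vertex $v$ (given any current seed set $S$) visits, in expectation over the random choice of centers, $O(R\cdot\min(1/\alpha, T))$ vertices, where $T=\frac{1}{R}\sum_{r=1}^{R} T_r$ and $T_r$ is the number of vertices in the connected component of $v$ in the $r$-th sampled graph $G'_r$.
   Context: Independent Cascade (IC) model on an undirected graph $G=(V,E)$: each edge $e$ has a propagation probability $p_e\in[0,1]$. For $r=1,\dots,R$, the $r$-th sampled graph is $G'_r=(V,E'_r)$, where each edge $e\in E$ is retained with probability $p_e$; whether $e$ is retained in $G'_r$ is determined deterministically by a random number generated from the pair $(e,r)$, so $G'_r$ is not stored explicitly and can be reconstructed from $r$. A set $C=\{c_1,\dots,c_\rho\}\subseteq V$ of $\rho=\alpha n$ ''centers'' is selected uniformly at random (so that each vertex is a center with probability $\alpha$, independently), shared by all sketches, with a global length-$n$ flag array marking which vertices are centers. The $r$-th sketch is a triple $\langle r,\textit{label}[1..\rho],\textit{size}[1..\rho]\rangle$: $\textit{label}[i]$ is the smallest index $j$ such that $c_j$ lies in the same connected component of $G'_r$ as $c_i$, and for $i$ with $\textit{label}[i]=i$, $\textit{size}[i]$ is the size of that connected component (set to $0$ once some vertex of that component is chosen as a seed). The marginal gain of a vertex $v$ with respect to the current seed set $S$ is estimated as the average over $r=1,\dots,R$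 of a value $\delta_r$ obtained as follows: run a breadth-first search from $v$ in $G'_r$, stopping as soon as a center $c_i$ is visited; if a center is found, $\delta_r=\textit{size}[\textit{label}[i]]$; otherwise the search exhausts the connected component of $v$ and $\delta_r$ is the number of vertices visited, or $0$ if some vertex of $S$ was visited. The ''number of vertices visited'' in a re-evaluation is the total number of vertices visited by these $R$ searches. *)

(* Defs.v *)
From mathcomp Require Import all_boot all_order all_algebra.

Set Implicit Arguments.
Unset Strict Implicit.
Unset Printing Implicit Defensive.

Import Order.TTheory GRing.Theory Num.Theory.

Local Open Scope ring_scope.

(* A finite simple undirected graph given by adjacency lists, with the
   propagation probabilities of the Independent Cascade model. The lists may
   be in any order, so no tie-breaking rule for breadth-first search is
   imposed. The edge {u, w} is the set [set u; w]; the values of ic_prob on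
   other sets are irrelevant. *)
Record icGraph (F : realFieldType) (V : finType) := ICGraph {
  ic_adj : V -> seq V;
  ic_prob : {set V} -> F;
  ic_adj_uniq : forall u, uniq (ic_adj u);
  ic_adj_sym : forall u w, (w \in ic_adj u) = (u \in ic_adj w);
  ic_adj_irr : forall u, u \notin ic_adj u;
  ic_prob01 : forall u w, w \in ic_adj u -> 0 <= ic_prob [set u; w] <= 1
}.

(* rnd e r is the number in [0, 1) generated from the pair (e, r): for a number
   uniform in [0, 1), the event rnd e r < p_e has probability p_e. *)
Definition sampled_adj (F : realFieldType) (V : finType) (G : icGraph F V)
    (rnd : {set V} -> nat -> F) (r : nat) (u : V) : seq V :=
  [seq w <- ic_adj G u | rnd [set u; w] r < ic_prob G [set u; w]].

Section Components.
Variables (V : finType) (adj : V -> seq V).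

Definition component (u : V) : {set V} := [set w | connect (grel adj) u w].

(* The visited vertices, in order of visit. Every vertex enters the queue at
   most once, so fuel #|V| is enough for the search to run to its end. *)
Fixpoint bfs_loop (stop : pred V) (fuel : nat) (queue seen : seq V) : seq V :=
  match fuel, queue with
  | k.+1, u :: q =>
      u :: (if stop u then [::]
            else let new := [seq w <- adj u | w \notin seen] in
                 bfs_loop stop k (q ++ new) (seen ++ new))
  | _, _ => [::]
  end.

Definition bfs (stop : pred V) (v : V) : seq V :=
  bfs_loop stop #|V| [:: v] [:: v].

End Components.

(* Indices of centers start at 0: c_i is the i-th element of enum C. *)
Record sketch := Sketch {
  sk_id : nat;
  sk_label : seq nat;
  sk_size : seq nat
}.

Record store (V : finType) := Store {
  st_flags : seq bool;
  st_centers : seq V;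
  st_sketches : seq sketch
}.

(* Space is counted in machine words, one per array entry. The id r takes a
   word too, so R sketches take at least R words; this is within
   O((1 + alpha * R) * n) only because there is at least one center, that is,
   1 <= alpha * n. *)
Definition sketch_words (sk : sketch) : nat :=
  (1 + size (sk_label sk) + size (sk_size sk))%N.

Definition store_words (V : finType) (st : store V) : nat :=
  (size (st_flags st) + size (st_centers st)
   + sumn [seq sketch_words sk | sk <- st_sketches st])%N.

Section Scheme.
Variables (F : realFieldType) (V : finType) (G : icGraph F V).
Variables (rnd : {set V} -> nat -> F) (R : nat).

Definition sample_component (r : nat) (u : V) : {set V} :=
  component (sampled_adj G rnd r) u.

Definition center_label (C : {set V}) (r : nat) (c : V) : nat :=
  find (fun c' => c' \in sample_component r c) (enum C).

(* The scheme reads size[i] only when label[i] = i; other entries are 0. *)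
Definition center_size (C S : {set V}) (r : nat) (c : V) : nat :=
  if (center_label C r c == index c (enum C))
     && [disjoint sample_component r c & S]
  then #|sample_component r c| else 0%N.

Definition make_sketch (C S : {set V}) (r : nat) : sketch :=
  Sketch r [seq center_label C r c | c <- enum C]
           [seq center_size C S r c | c <- enum C].

Definition make_store (C S : {set V}) : store V :=
  Store [seq u \in C | u <- enum V] (enum C)
        [seq make_sketch C S r | r <- iota 1 R].

Definition scheme_space (C S : {set V}) : nat := store_words (make_store C S).

(* The pair of delta_r and the number of vertices visited. *)
Definition sketch_query (C S : {set V}) (v : V) (sk : sketch) : nat * nat :=
  let visited := bfs (sampled_adj G rnd (sk_id sk)) [in C] v in
  let delta :=
    if has [in C] visited then
      let i := index (last v visited) (enum C) in
      nth 0%N (sk_size sk) (nth 0%N (sk_label sk) i)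
    else if has [in S] visited then 0%N else size visited in
  (delta, size visited).

(* The pair of the estimated marginal gain of v and the total number of
   vertices visited to compute it. *)
Definition reevaluate (C S : {set V}) (v : V) : F * nat :=
  let answers :=
    [seq sketch_query C S v sk | sk <- st_sketches (make_store C S)] in
  ((sumn (unzip1 answers))%:R / R%:R, sumn (unzip2 answers)).

Definition visited_vertices (C S : {set V}) (v : V) : nat :=
  (reevaluate C S v).2.

Definition avg_component_size (v : V) : F :=
  R%:R^-1 * \sum_(1 <= r < R.+1) #|sample_component r v|%:R.

End Scheme.

(* Two readings of a random set of alpha * n centers: uniform among the sets
   with rho elements, and independent with probability alpha. *)
Definition uniform_centers (F : realFieldType) (V : finType) (rho : nat)
    (C : {set V}) : F :=
  if #|C| == rho then ('C(#|V|, rho))%:R^-1 else 0.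

Definition bernoulli_centers (F : realFieldType) (V : finType) (alpha : F)
    (C : {set V}) : F :=
  \prod_(u : V) (if u \in C then alpha else 1 - alpha).

Definition expect (F : realFieldType) (V : finType) (law : {set V} -> F)
    (X : {set V} -> F) : F :=
  \sum_(C : {set V}) law C * X C.

(* rho = alpha * n when this is an integer; otherwise alpha * n rounded either
   way. *)
Definition center_count (F : realFieldType) (alpha : F) (n rho : nat) : Prop :=
  `|rho%:R - alpha * n%:R| < 1.

(* Main.v *)
(* A search stopped at the first center visits a prefix of the search that
   exhausts the component, and its expected length is the sum over k of the
   probability that the first k vertices of that search contain no center.
   This probability is (1 - alpha)^k for independent centers, with sum at most
   1 / alpha, and 'C(n - k, rho) / 'C(n, rho) for rho uniform centers, with sum
   (n + 1) / (rho + 1) <= 2 / alpha since rho + 1 > alpha * n. *)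
Require Import Defs.
From mathcomp Require Import all_boot all_order all_algebra.
From mathcomp Require Import lra zify.

Import Order.TTheory GRing.Theory Num.Theory.
Local Open Scope ring_scope.

(** * Stopped and exhaustive breadth-first search *)

Section Search.
Variables (V : finType) (adj : V -> seq V).
Implicit Types (stop : pred V) (q seen : seq V).

(** The test [stop] decides when the loop ends, never the order of visits. If no vertex stops the
    search, [find] returns the length and [take] keeps the whole list. *)
Lemma bfs_loop_take stop k q seen :
  let full := bfs_loop adj pred0 k q seen in
  bfs_loop adj stop k q seen = take (find stop full).+1 full.
Proof.
elim: k q seen => [|k IHk] [|u q] seen //=.
by case: (stop u); rewrite ?take0 // IHk.
Qed.

(** Only unseen vertices are ever enqueued, so a seen vertex that has left the queue never comes
    back. *)
Lemma bfs_loop_mem k q seen w : {subset q <= seen} ->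
  w \in bfs_loop adj pred0 k q seen -> (w \in q) || (w \notin seen).
Proof.
elim: k q seen => [|k IHk] [|u q] seen //= q_seen.
rewrite !inE => /predU1P[-> | /IHk]; first by rewrite eqxx.
have sub' : {subset q ++ [seq w <- adj u | w \notin seen]
                  <= seen ++ [seq w <- adj u | w \notin seen]}.
  move=> x; rewrite !mem_cat => /orP[x_q | ->]; rewrite ?orbT //.
  by rewrite q_seen // inE x_q orbT.
move=> /(_ sub'); rewrite !mem_cat mem_filter negb_or.
by case: (w \in q); case: (w \in seen); rewrite ?orbT //= andbF.
Qed.

(** The head [u] is seen and has left the queue, so [bfs_loop_mem] excludes a second visit. *)
Lemma bfs_loop_uniq k q seen : (forall u, uniq (adj u)) ->
  uniq q -> {subset q <= seen} -> uniq (bfs_loop adj pred0 k q seen).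
Proof.
move=> adj_uniq; elim: k q seen => [|k IHk] [|u q] seen //=.
case/andP=> u_q q_uniq q_seen; have u_seen : u \in seen by rewrite q_seen ?mem_head.
set new := [seq w <- adj u | w \notin seen].
have sub' : {subset q ++ new <= seen ++ new}.
  move=> w; rewrite !mem_cat => /orP[w_q | ->]; rewrite ?orbT //.
  by rewrite q_seen // inE w_q orbT.
apply/andP; split.
  apply/negP => /(bfs_loop_mem _ _ _ _ sub').
  by rewrite !mem_cat (negPf u_q) mem_filter u_seen.
apply: IHk => //; rewrite cat_uniq q_uniq filter_uniq // andbT.
apply/hasPn => w; rewrite mem_filter => /andP[w_seen _].
by apply: contra w_seen => w_q; rewrite q_seen // inE w_q orbT.
Qed.

Lemma bfs_loop_component v k q seen :
  {subset q <= component adj v} ->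
  {subset bfs_loop adj pred0 k q seen <= component adj v}.
Proof.
elim: k q seen => [|k IHk] [|u q] seen //= q_v w.
have u_v : u \in component adj v by rewrite q_v ?mem_head.
rewrite inE => /predU1P[-> // | ]; apply: IHk => x.
rewrite mem_cat mem_filter => /orP[x_q | /andP[_ x_u]].
  by rewrite q_v // inE x_q orbT.
move: u_v; rewrite !inE => /connect_trans; apply; exact: connect1.
Qed.

End Search.

(** Position [k] belongs to the prefix exactly when no earlier entry satisfies [a]. Writing the
    length as a sum of indicators prepares for linearity of expectation. *)
Lemma size_take_find (T : Type) (a : pred T) (s : seq T) :
  size (take (find a s).+1 s) = (\sum_(k < size s) ~~ has a (take k s))%N.
Proof.
elim: s => [|x s IHs] /=; first by rewrite big_ord0.
rewrite big_ord_recl /= add1n; congr _.+1.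
case: (a x) => /=; first by rewrite take0 big1.
exact: IHs.
Qed.

Lemma hockey_stick n m : (\sum_(k < n.+1) 'C(n - k, m) = 'C(n.+1, m.+1))%N.
Proof.
elim: n => [|n IHn]; first by rewrite big_ord1 binS (@bin_small 0).
by rewrite big_ord_recl subn0 [RHS]binS -IHn addnC.
Qed.

(** * Probability that the random centers avoid a fixed vertex set *)

Section Laws.
Variables (F : realFieldType) (V : finType).
Implicit Types (law : {set V} -> F) (X Y : {set V} -> F) (A C : {set V}).

Definition avoidance law A : F := expect law (fun C => [disjoint A & C]%:R).

Lemma eq_expect law X Y : X =1 Y -> expect law X = expect law Y.
Proof. by move=> XY; apply: eq_bigr => C _; rewrite XY. Qed.

Lemma expect_sum law (I : Type) (s : seq I) (P : pred I) (X : I -> {set V} -> F) :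
  expect law (fun C => \sum_(i <- s | P i) X i C)
    = \sum_(i <- s | P i) expect law (X i).
Proof.
by rewrite exchange_big; apply: eq_bigr => C _; rewrite mulr_sumr.
Qed.

Lemma expectZ law (a : F) X : expect law (fun C => a * X C) = a * expect law X.
Proof. by rewrite [RHS]mulr_sumr; apply: eq_bigr => C _; rewrite mulrCA. Qed.

Lemma expectD law X Y :
  expect law (fun C => X C + Y C) = expect law X + expect law Y.
Proof. by rewrite -big_split; apply: eq_bigr => C _; rewrite mulrDr. Qed.

(** No normalisation of [law] is assumed: [avoidance law set0] is its total mass, as every set is
    disjoint from [set0]. *)
Lemma expect_cst law (a : F) : expect law (fun=> a) = a * avoidance law set0.
Proof.
rewrite -expectZ; apply: eq_expect => C.
by rewrite disjoints_subset sub0set mulr1.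
Qed.

(** The favourable outcomes are the [rho]-element subsets of the complement of [A], counted by
    [cards_draws]. *)
Lemma avoidance_uniform rho A :
  avoidance (uniform_centers F rho) A
    = 'C(#|V| - #|A|, rho)%:R / 'C(#|V|, rho)%:R.
Proof.
rewrite -(cardsC A) addKn cardsC -cards_draws -sum1_card natr_sum mulr_suml.
rewrite big_mkcond; apply: eq_bigr => C _.
rewrite /uniform_centers inE disjoint_sym disjoints_subset.
by case: (C \subset ~: A); case: eqP; rewrite ?(mulr0, mul0r, mul1r, mulr1).
Qed.

Lemma avoidance_bernoulli (alpha : F) A :
  avoidance (bernoulli_centers alpha) A = (1 - alpha) ^+ #|A|.
Proof.
(* Expanding this product, [C] collects the vertices where the first summand is chosen; a term
   vanishes as soon as [C] meets [A]. Factors outside [A] equal 1. *)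
transitivity (\prod_(u : V) (alpha * (u \notin A)%:R + (1 - alpha))).
  rewrite bigA_distr; apply: eq_bigr => C _; rewrite /bernoulli_centers.
  have [AC | /pred0Pn[u /andP[/= uA uC]]] := boolP [disjoint A & C].
    rewrite mulr1; apply: eq_bigr => u _; case: ifP => // uC.
    by rewrite (disjointFl AC uC) mulr1.
  by rewrite mulr0 [RHS](bigD1 u) //= uC uA mulr0 mul0r.
rewrite (bigID [in A]) /= [X in _ * X]big1 => [|u ->]; last first.
  by rewrite mulr1 addrC subrK.
rewrite mulr1 -prodr_const; apply: eq_bigr => u ->.
by rewrite mulr0 add0r.
Qed.

End Laws.

(** * Search cost under a law whose avoidance probability depends only on cardinality *)

Section Reevaluation.
Variables (F : realFieldType) (V : finType) (law : {set V} -> F) (p : nat -> F).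
Hypothesis avoidanceE : forall A, avoidance F V law A = p #|A|.
Hypothesis p01 : forall k, 0 <= p k <= 1.

(** The exhaustive search has no repetition, so its first [k] entries form a set of [k] vertices,
    avoided with probability [p k]. *)
Lemma expect_size_bfs (adj : V -> seq V) (v : V) : (forall u, uniq (adj u)) ->
  expect law (fun C => (size (bfs adj [in C] v))%:R)
    = \sum_(k < size (bfs adj pred0 v)) p k.
Proof.
move=> adj_uniq; set s := bfs adj pred0 v.
have s_uniq : uniq s by apply: bfs_loop_uniq.
transitivity (expect law
    (fun C => \sum_(k < size s) [disjoint [set x in take k s] & C]%:R)).
  apply: eq_expect => C; rewrite /bfs bfs_loop_take size_take_find natr_sum.
  apply: eq_bigr => k _; congr (nat_of_bool _)%:R.
  by rewrite -disjoint_has; apply: eq_disjoint => x; rewrite inE.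
rewrite expect_sum; apply: eq_bigr => k _; rewrite -/(avoidance F V law _).
rewrite avoidanceE cardsE (card_uniqP _) ?take_uniq // size_take ltn_ord //.
Qed.

(** The same sum is bounded twice: [0 <= p k] lets it be extended to [#|V|.+1] terms, and [p k <= 1]
    bounds it by the length of a search that stays in the component. *)
Lemma expect_size_bfs_le (adj : V -> seq V) (v : V) (b : F) :
  (forall u, uniq (adj u)) -> \sum_(k < #|V|.+1) p k <= b ->
  expect law (fun C => (size (bfs adj [in C] v))%:R)
    <= Num.min b #|component adj v|%:R.
Proof.
move=> adj_uniq p_b; rewrite expect_size_bfs // le_min.
have s_uniq : uniq (bfs adj pred0 v) by apply: bfs_loop_uniq.
set s := bfs adj pred0 v in s_uniq *.
apply/andP; split.
  apply: le_trans p_b; rewrite -!(big_mkord predT p).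
  have sV : (size s <= #|V|.+1)%N by rewrite leqW // -(card_uniqP s_uniq) max_card.
  rewrite (@big_cat_nat _ _ _ _ _ _ _ _ _ sV) //= lerDl sumr_ge0 // => k _.
  by case/andP: (p01 k).
apply: (@le_trans _ _ (size s)%:R).
  rewrite -[X in _ <= X%:R]card_ord -sumr_const; apply: ler_sum => k _.
  by case/andP: (p01 k).
rewrite ler_nat -(card_uniqP s_uniq); apply/subset_leq_card/subsetP.
apply: bfs_loop_component => w; rewrite !inE => /eqP->; exact: connect0.
Qed.

Lemma expect_visited_le (G : icGraph F V) (rnd : {set V} -> nat -> F) (R : nat)
    (S : {set V}) (v : V) (b : F) :
  (0 < R)%N -> \sum_(k < #|V|.+1) p k <= b ->
  expect law (fun C => (visited_vertices G rnd R C S v)%:R)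
    <= R%:R * Num.min b (avg_component_size G rnd R v).
Proof.
move=> R_gt0 p_b.
rewrite (_ : expect _ _ = \sum_(1 <= r < R.+1)
    expect law (fun C => (size (bfs (sampled_adj G rnd r) [in C] v))%:R)).
  (* The factor [R%:R] moves inside the minimum; each of the two bounds then keeps one side of the
     minimum obtained for each sketch. *)
  rewrite minr_pMr ?ler0n // le_min; apply/andP; split.
    rewrite mulr_natl -[X in b *+ X](subn1 R.+1) -sumr_const_nat.
    apply: ler_sum => r _; apply: le_trans (expect_size_bfs_le _ _ _ _ p_b) _.
      by move=> u; rewrite filter_uniq // ic_adj_uniq.
    by rewrite ge_min lexx.
  rewrite mulrA divff ?mul1r ?pnatr_eq0 -?lt0n //.
  apply: ler_sum => r _; apply: le_trans (expect_size_bfs_le _ _ _ _ p_b) _.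
    by move=> u; rewrite filter_uniq // ic_adj_uniq.
  by rewrite ge_min lexx orbT.
rewrite -expect_sum; apply: eq_expect => C.
rewrite -natr_sum /visited_vertices /= sumnE /unzip2 -!map_comp big_map.
by rewrite /index_iota subn1.
Qed.

End Reevaluation.

(** * The geometric and hypergeometric tail sums *)

Section Numeric.
Variable F : realFieldType.

Lemma geometric_sum_le (alpha : F) n : 0 < alpha <= 1 ->
  \sum_(k < n) (1 - alpha) ^+ k <= alpha^-1.
Proof.
case/andP=> a_gt0 a_le1.
have telescope := GRing.subrX1 (1 - alpha) n.
rewrite -(ler_pM2l a_gt0) divff ?gt_eqF //.
have : 0 <= (1 - alpha) ^+ n by rewrite exprn_ge0 // subr_ge0.
by lra.
Qed.

(** The hockey-stick sum is ['C(n.+1, m.+1)], whose ratio to ['C(n, m)] follows from the diagonal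
    identity; [m <= n] keeps the denominator nonzero. *)
Lemma binomial_ratio_sum (n m : nat) : (m <= n)%N ->
  \sum_(k < n.+1) ('C(n - k, m)%:R / 'C(n, m)%:R : F) = n.+1%:R / m.+1%:R.
Proof.
move=> le_mn; rewrite -mulr_suml -natr_sum hockey_stick.
apply/eqP; rewrite eqr_div ?pnatr_eq0 -?lt0n ?bin_gt0 // -!natrM eqr_nat.
by rewrite mulnC mul_bin_diag.
Qed.

End Numeric.

(** * Word count of the store *)

Section Space.
Variables (F : realFieldType) (V : finType) (G : icGraph F V).
Variables (rnd : {set V} -> nat -> F) (R : nat).

Lemma scheme_spaceE (C S : {set V}) :
  scheme_space G rnd R C S = (#|V| + #|C| + R * (1 + 2 * #|C|))%N.
Proof.
rewrite /scheme_space /store_words /= size_map -!cardE; congr (_ + _)%N.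
rewrite -map_comp sumnE big_map.
rewrite (eq_bigr (fun=> 1 + 2 * #|C|)%N) => [|r _].
  by rewrite big_const_seq count_predT size_iota iter_addn_0 mulnC.
by rewrite /sketch_words /= !size_map -!cardE; lia.
Qed.

End Space.

(** A vertex is a center unless [C] avoids its singleton, which has probability [1 - alpha]. *)
Lemma expect_card_bernoulli (F : realFieldType) (V : finType) (alpha : F) :
  expect (bernoulli_centers alpha) (fun C : {set V} => #|C|%:R) = alpha * #|V|%:R.
Proof.
transitivity (expect (bernoulli_centers alpha) (fun C : {set V} =>
    \sum_(u : V) (1 + -1 * [disjoint [set u] & C]%:R))).
  apply: eq_expect => C; rewrite -sum1_card natr_sum big_mkcond.
  apply: eq_bigr => u _; rewrite disjoints1.
  by case: (u \in C); rewrite /= ?mulr0 ?mulr1 ?addr0 ?subrr.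
rewrite expect_sum; under eq_bigr => u _.
  rewrite expectD expectZ expect_cst -/(avoidance F V _ _) !avoidance_bernoulli.
  rewrite cards0 cards1 expr0 expr1 mulr1 mulN1r opprB addrC subrK.
  over.
by rewrite sumr_const mulr_natr.
Qed.

Theorem theorem3p1 (F : realFieldType) :
  exists c : F, 0 < c /\
  forall (V : finType) (G : icGraph F V) (rnd : {set V} -> nat -> F)
         (R : nat) (alpha : F),
    (forall e r, 0 <= rnd e r < 1) ->
    (0 < R)%N ->
    0 < alpha <= 1 ->
    (1 <= alpha * #|V|%:R ->
       forall S : {set V},
         (forall (rho : nat) (C : {set V}),
            center_count alpha #|V| rho -> #|C| = rho ->
            (scheme_space G rnd R C S)%:R
              <= c * ((1 + alpha * R%:R) * #|V|%:R))
         /\ expect (bernoulli_centers alpha)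
              (fun C => (scheme_space G rnd R C S)%:R)
              <= c * ((1 + alpha * R%:R) * #|V|%:R))
    /\
    (forall (v : V) (S : {set V}),
       (forall rho : nat,
          center_count alpha #|V| rho ->
          expect (uniform_centers F rho)
            (fun C => (visited_vertices G rnd R C S v)%:R)
            <= c * (R%:R * Num.min alpha^-1 (avg_component_size G rnd R v)))
       /\ expect (bernoulli_centers alpha)
            (fun C => (visited_vertices G rnd R C S v)%:R)
            <= c * (R%:R * Num.min alpha^-1 (avg_component_size G rnd R v))).
Proof.
(* Space dictates the 5: with [x <= 2 * alpha * n] and [1 <= alpha * n], each sketch costs
   [1 + 2 * x <= 5 * alpha * n]. The time bound would only ask for 2. *)
exists 5; split; first by lra.
move=> V G rnd R alpha _ R_gt0 a01; have /andP[a_gt0 a_le1] := a01.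
split=> [an_ge1 S | v S].
  have space_le (x : F) : 0 <= x -> x <= 2 * (alpha * #|V|%:R) ->
      #|V|%:R + x + R%:R * (1 + 2 * x) <= 5 * ((1 + alpha * R%:R) * #|V|%:R).
    move=> x_ge0 x_le.
    have : alpha * #|V|%:R <= #|V|%:R by rewrite ler_piMl.
    have := ler_wpM2l (ler0n F R) x_le; have := ler_wpM2l (ler0n F R) an_ge1.
    by nra.
  (* Here [rho < alpha * n + 1 <= 2 * alpha * n]. *)
  split=> [rho C /ltr_normlP[_ rho_lt] cardC | ].
    rewrite scheme_spaceE cardC !(natrD, natrM).
    by apply: space_le => //; lra.
  (* The space is affine in [#|C|], so its expectation is its value at [alpha * n]. *)
  rewrite (eq_expect _ _ _ _ (fun C => (#|V| + R)%:R + (1 + 2 * R)%:R * #|C|%:R)).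
    rewrite expectD expectZ expect_cst avoidance_bernoulli cards0 expr0 mulr1.
    rewrite expect_card_bernoulli !(natrD, natrM).
    have /space_le : 0 <= alpha * #|V|%:R by lra.
    by move=> /(_ ltac:(lra)); nra.
  by move=> C; rewrite scheme_spaceE -natrM -natrD; congr _%:R; lia.
(* The factor 2 on [alpha^-1] is the one the uniform law produces; 5 absorbs it. *)
have le5 (x : F) : x <= R%:R * Num.min (2 * alpha^-1) (avg_component_size G rnd R v) ->
    x <= 5 * (R%:R * Num.min alpha^-1 (avg_component_size G rnd R v)).
  move=> /le_trans; apply; rewrite mulrCA ler_wpM2l //.
  have ia_gt0 : 0 < alpha^-1 by rewrite invr_gt0.
  have T_ge0 : 0 <= avg_component_size G rnd R v.
    by rewrite mulr_ge0 ?invr_ge0 ?sumr_ge0.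
  rewrite minr_pMr ?ler0n // le_min !ge_min.
  by apply/andP; split; apply/orP; [left | right]; lra.
split=> [rho /ltr_normlP[rho_lt rho_gt] | ]; apply: le5.
  (* From [rho < alpha * n + 1 <= n + 1]. *)
  have rho_le : (rho <= #|V|)%N.
    rewrite -ltnS -(ltr_nat F) -natr1.
    have : alpha * #|V|%:R <= #|V|%:R by rewrite ler_piMl.
    by lra.
  apply: (expect_visited_le _ _ _
    (fun k => 'C(#|V| - k, rho)%:R / 'C(#|V|, rho)%:R)) => //.
  - exact: avoidance_uniform.
  - move=> k; rewrite divr_ge0 ?ler0n //= ler_pdivrMr ?ltr0n ?bin_gt0 // mul1r.
    by rewrite ler_nat leq_bin2l // leq_subr.
  (* The goal becomes [(n + 1) * alpha <= 2 * (rho + 1)], by [alpha * n < rho + 1] and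
     [alpha <= 1]. *)
  - rewrite binomial_ratio_sum // ler_pdivrMr ?ltr0n // mulrAC ler_pdivlMr //.
    by have := ler0n F rho; rewrite -!natr1; lra.
apply: (expect_visited_le _ _ _ (fun k => (1 - alpha) ^+ k)) => //.
- exact: avoidance_bernoulli.
- by move=> k; rewrite exprn_ge0 ?exprn_ile1 //; lra.
- apply: le_trans (geometric_sum_le _ _ _ a01) _.
  have : 0 < alpha^-1 by rewrite invr_gt0.
  by lra.
Qed.
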